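(* Consider an MDP $\mathcal M$, a finite transmission power set $\Omega_p$, and a state-dependent dropout channel (SDDC) with dropout probabilities $\theta(s,p)$, as described in the context. Consider the NCS $x_{k+1}=f(x_k,u_k,w_k)$, $\hat x_k=\gamma_kx_k+(1-\gamma_k)\hat x_{k-1}$, $u_k=K(\hat x_k)$ with an ultimately bounded disturbance $w$ (i.e. there is $0<M_w<\infty$ with $|w|_{\mathcal L_\infty}\le M_w$), written in closed loop as the switched system $z_{k+1}=f_{\gamma_k}(z_k,w_k)$ with $z_k=[x_k;\hat x_{k-1}]$. Suppose that there are functions $V_0,V_1$ of the state of the switched system, class $\mathcal K_\infty$ functions $\alpha_1,\alpha_2$, a class $\mathcal K$ function $\chi$, and constants $\varrho,\lambda_0,\lambda_1>0$ (where $\lambda_0>\lambda_1$ and $\varrho\lambda_1<1$) such that for all states $y$ and disturbances $w$: $\alpha_1(|y|)\le V_i(y)\le\alpha_2(|y|)$ for $i\in\{0,1\}$; $V_i(f_i(y,w))\le\lambda_iV_i(y)+\chi(|w|)$ for $i\in\{0,1\}$; $V_i(y)\le\varrho V_j(y)$ for $i\ne j$ in $\{0,1\}$; and $\varrho\min_i\lambda_i<1$. The NCS is practically safe in probability (PSP) if, for a given $\eta\in(\lambda_1\varrho,1)$, there exists a joint policy $\mu=\{\mu_k\}$ such that for all $k$ and all $(s,p)\in S\times\Omega_p$ $$\sum_{s'\in S,\;p'\in\Omega_p}\theta(s',p')\,\mu_k^p(p')\sum_{a\in A(s)}p(s'|s,a)\,\mu_k^m(a)\le\frac{\eta-\lambda_1\varrho}{\varrho(\lambda_0-\lambda_1)},$$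 where $\mu_k^p(p')=\mathbb P\{p'\mid s_k=s\}$ and $\mu_k^m(a)=\mathbb P\{a\mid s_k=s\}$. In particular, let $\Omega_s=\{x\in\mathbb R^n:|x|\le\Delta\}$ denote the target region towards which the state is driven. Then the bound $\lim_{k\to\infty}\mathbb P\{|x_k|\ge\epsilon+\Delta\}\le\rho_\epsilon(\Delta,M_w)$ on the probability of exiting $\Omega_s$ holds with $$\rho_\epsilon(\Delta,M_w)=\frac{\chi(M_w)}{(1-\eta)\,\alpha_1(\Delta+\epsilon)}.$$
   Context: Notation. $|\cdot|$ is the infinity norm of a vector, and $|w|_{\mathcal L_\infty}=\operatorname{ess\,sup}_{k\ge0}\|w(k)\|_2$. A function $\alpha:\mathbb R_{\ge0}\to\mathbb R_{\ge0}$ is of class $\mathcal K$ if it is continuous, strictly increasing and $\alpha(0)=0$; it is of class $\mathcal K_\infty$ if moreover it is radially unbounded. MDP. A Markov decision process (MDP) $\mathcal M$ has finite state set $S=\{1,\dots,N\}$, finite action set $A$ (with $A(s)$ the actions available at $s$), and transition probabilities $p(s'|s,a)$ from $s$ to $s'$ under action $a$. $\Omega_p=\{p_1,\dots,p_M\}$ is a finite set of transmission power levels. Joint policy and joint chain. A joint policy $\mu=\{\mu_k\}_{k\ge0}$, $\mu_k=(\mu_k^m,\mu_k^p)$, consists of randomized decision rules $\mu_k^m(a)=\mathbb P\{a\mid s_k=s\}$ on actions and $\mu_k^p(p')=\mathbb P\{p'\mid s_k=s\}$ on power levels. The joint state $\overline s_k=(s_k,p_k)$ is a Markov chain on $S\times\Omega_p$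 with transition probabilities from $\overline s=(s,p)$ to $\overline s'=(s',p')$ at time $k$ $$\overline P_k(\overline s,\overline s')=\mathbb P\{\overline s_{k+1}=\overline s'\mid\overline s_k=\overline s\}=\mu_k^p(p')\sum_{a\in A(s)}p(s'|s,a)\mu_k^m(a).$$ SDDC. $\gamma_k\in\{0,1\}$, where $\gamma_k=1$ means the packet at time $k$ is received and $\gamma_k=0$ that it is dropped. For all $i\in S$, $p\in\Omega_p$, $k\in\mathbb Z_{\ge0}$: $\mathbb P\{\gamma_k=0\mid s_k=i,p_k=p\}=\theta(i,p)\in[0,1)$, where $\theta(i,p)$ is monotonically decreasing in $p$. Given the joint states, the $\gamma_k$ are conditionally independent over time. NCS. $x_k\in\mathbb R^n$, $u_k\in\mathbb R^l$, $w_k\in\mathbb R^m$; the estimator has zero initial estimate $\hat x_{-1}=0$; $K:\mathbb R^n\to\mathbb R^l$ is a controller map. With $z_k=[x_k;\hat x_{k-1}]\in\mathbb R^{2n}$ the closed loop is the randomly switched system $z_{k+1}=f_{\gamma_k}(z_k,w_k)$. Multiple-Lyapunov-function assumption. There are functions $V_0,V_1$ of the state of the switched system, class $\mathcal K_\infty$ functions $\alpha_1,\alpha_2$, a class $\mathcal K$ function $\chi$, and constants $\varrho,\lambda_0,\lambda_1>0$ such that for all states $y$ and disturbances $w$: (V1) $\alpha_1(|y|)\le V_i(y)\le\alpha_2(|y|)$ for $i\in\{0,1\}$; (V2) $V_i(f_i(y,w))\le\lambda_iV_i(y)+\chi(|w|)$ for $i\in\{0,1\}$; (V3) $V_i(y)\le\varrho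 V_j(y)$ for $i\ne j$; (V4) $\varrho\min_i\lambda_i<1$. It is understood that $\lambda_0>\lambda_1$, so that $\varrho\lambda_1<1$. PSP. Let $\Omega_s$ be a bounded region (closed infinity-norm ball centred at the origin). The NCS with disturbance satisfying $|w|_{\mathcal L_\infty}\le M_w$ is practically safe in probability if for any $\epsilon>0$ and $\Delta>0$ there exists $\rho_\epsilon(\Delta,M_w)\in(0,1)$ such that for all $x_0\in\Omega_s$, $\lim_{k\to\infty}\mathbb P\{|x_k|\ge\epsilon+\Delta\}\le\rho_\epsilon(\Delta,M_w)$.
   Formalization: PSP with a level in (0,1) is asserted only for those ε, Δ > 0 with ρ_ε(Δ,M_w) < 1, since for arbitrarily small ε+Δ it fails under a persistent disturbance; the explicit bound, with limit superior in place of the limit, is proved for all ε, Δ > 0. *)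

(* Defs.v *)
From HB Require Import structures.
From mathcomp Require Import all_boot all_order all_algebra finmap.
From mathcomp Require Import all_classical all_reals all_analysis.
From mathcomp Require Import ess_sup_inf.

Set Implicit Arguments.
Unset Strict Implicit.
Unset Printing Implicit Defensive.

Import Order.TTheory GRing.Theory Num.Theory.
Import numFieldNormedType.Exports.

Local Open Scope classical_set_scope.
Local Open Scope ring_scope.

(* On 'cV[R]_n, `|x| is the library's matrix norm, i.e. the infinity norm. *)

Definition norm2 (R : realType) (m : nat) (v : 'cV[R]_m) : R :=
  Num.sqrt (\sum_(i < m) v i ord0 ^+ 2).

Definition Linfty_norm (R : realType) (m : nat) (w : nat -> 'cV[R]_m) : \bar R :=
  ess_sup (counting : {measure set nat -> \bar R}) (fun k => (norm2 (w k))%:E).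

(* A comparison function on the nonnegative reals is the restriction to
   [0, +oo[ of a function on R; its values on negative reals are irrelevant,
   and its nonnegativity follows from the last two conditions. *)
Definition classK (R : realType) (alpha : R -> R) : Prop :=
  [/\ {within `[0, +oo[, continuous alpha},
      {in `[0, +oo[ &, {homo alpha : x y / x < y}} &
      alpha 0 = 0].

Definition classKoo (R : realType) (alpha : R -> R) : Prop :=
  classK alpha /\ alpha r @[r --> +oo] --> +oo.

(* [trans s a s'] is p(s'|s,a); only available actions are constrained. *)
Record mdp (R : realType) (S A : finType) := Mdp {
  avail : S -> {set A};
  trans : S -> A -> S -> R;
  trans_ge0 : forall s a s', a \in avail s -> 0 <= trans s a s';
  trans_sum1 : forall s a, a \in avail s -> \sum_(s' : S) trans s a s' = 1
}.

(* Both rules at time k are conditioned on the MDP state s_k only; [pol_p]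
   draws the power level used at time k+1. *)
Record joint_policy (R : realType) (S A : finType) (Omegap : {fset R})
    (M : mdp R S A) := JointPolicy {
  pol_m : nat -> S -> A -> R;
  pol_p : nat -> S -> Omegap -> R;
  pol_m_ge0 : forall k s a, a \in avail M s -> 0 <= pol_m k s a;
  pol_m_sum1 : forall k s, \sum_(a in avail M s) pol_m k s a = 1;
  pol_p_ge0 : forall k s p, 0 <= pol_p k s p;
  pol_p_sum1 : forall k s, \sum_(p : Omegap) pol_p k s p = 1
}.

Definition joint_trans (R : realType) (S A : finType) (Omegap : {fset R})
    (M : mdp R S A) (mu : joint_policy Omegap M) (k : nat)
    (t t' : S * Omegap) : R :=
  pol_p mu k t.1 t'.2 *
  \sum_(a in avail M t.1) trans M t.1 a t'.1 * pol_m mu k t.1 a.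

(* Only meaningful when P B != 0. *)
Definition cprob (R : realType) (d : measure_display) (T : measurableType d)
    (P : probability T R) (A B : set T) : R :=
  fine (P (A `&` B)) / fine (P B).

Definition path_event (T U : Type) (X : nat -> T -> U) (k : nat) (x : nat -> U)
    : set T :=
  [set om | forall j, (j <= k)%N -> X j om = x j].

(* [sbar k] is the joint state (s_k, p_k). The initial law is arbitrary. *)
Definition joint_chain (R : realType) (d : measure_display)
    (T : measurableType d) (P : probability T R)
    (S A : finType) (Omegap : {fset R}) (M : mdp R S A)
    (mu : joint_policy Omegap M) (sbar : nat -> T -> S * Omegap) : Prop :=
  (forall k t, measurable [set om | sbar k om = t]) /\
  (forall k (t : nat -> S * Omegap),
     P (path_event sbar k t) != 0%E ->
     cprob P [set om | sbar k.+1 om = t k.+1] (path_event sbar k t)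
     = joint_trans mu k (t k) (t k.+1)).

Definition dropout_prob (R : realType) (S : finType) (Omegap : {fset R})
    (theta : S -> Omegap -> R) : Prop :=
  (forall s p, 0 <= theta s p < 1) /\
  (forall s (p p' : Omegap), fsval p <= fsval p' -> theta s p' <= theta s p).

(* [gamma k om = false] is a dropout at time k. The last clause says that,
   given the joint states, the dropouts are independent, the law of gamma_k
   depending on the joint state at time k only. *)
Definition sddc (R : realType) (d : measure_display)
    (T : measurableType d) (P : probability T R)
    (S : finType) (Omegap : {fset R}) (theta : S -> Omegap -> R)
    (sbar : nat -> T -> S * Omegap) (gamma : nat -> T -> bool) : Prop :=
  [/\ forall k, measurable_fun setT (gamma k),
      forall k i p,
        P [set om | sbar k om = (i, p)] != 0%E ->
        cprob P [set om | gamma k om = false] [set om | sbar k om = (i, p)]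
        = theta i p &
      forall k (t : nat -> S * Omegap) (g : nat -> bool),
        P (path_event sbar k t) != 0%E ->
        cprob P (path_event gamma k g) (path_event sbar k t)
        = \prod_(j < k.+1)
            cprob P [set om | gamma j om = g j] [set om | sbar j om = t j]].

(* The estimate xhat_k computed from x_k and xhat_{k-1}. *)
Definition estimate (R : realType) (n : nat) (gam : bool) (x xprev : 'cV[R]_n)
    : 'cV[R]_n :=
  (gam%:R : R) *: x + (1 - gam%:R) *: xprev.

(* The map f_gam on the extended state z = [x_k; xhat_{k-1}]. *)
Definition closed_loop (R : realType) (n l m : nat)
    (f : 'cV[R]_n -> 'cV[R]_l -> 'cV[R]_m -> 'cV[R]_n)
    (K : 'cV[R]_n -> 'cV[R]_l)
    (gam : bool) (z : 'cV[R]_(n + n)) (w : 'cV[R]_m) : 'cV[R]_(n + n) :=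
  let xhat := estimate gam (usubmx z) (dsubmx z) in
  col_mx (f (usubmx z) (K xhat) w) xhat.

Fixpoint ext_state (R : realType) (n l m : nat)
    (f : 'cV[R]_n -> 'cV[R]_l -> 'cV[R]_m -> 'cV[R]_n)
    (K : 'cV[R]_n -> 'cV[R]_l)
    (gam : nat -> bool) (w : nat -> 'cV[R]_m) (x0 : 'cV[R]_n) (k : nat)
    : 'cV[R]_(n + n) :=
  if k is k'.+1 then
    closed_loop f K (gam k') (ext_state f K gam w x0 k') (w k')
  else col_mx x0 0.

Definition ncs_state (R : realType) (n l m : nat)
    (f : 'cV[R]_n -> 'cV[R]_l -> 'cV[R]_m -> 'cV[R]_n)
    (K : 'cV[R]_n -> 'cV[R]_l)
    (gam : nat -> bool) (w : nat -> 'cV[R]_m) (x0 : 'cV[R]_n) (k : nat)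
    : 'cV[R]_n :=
  usubmx (ext_state f K gam w x0 k).

(* The PSP bound with given eps, Delta and rho, where Omega_s is the closed
   ball of radius r. The disturbance may be random (deterministic ones are
   constant in om); the measurability requirement makes the event below an
   event, and holds for every deterministic disturbance. The limit in k need
   not exist, hence the limit superior. *)
Definition psp_bound (R : realType) (d : measure_display)
    (T : measurableType d) (P : probability T R) (n l m : nat)
    (f : 'cV[R]_n -> 'cV[R]_l -> 'cV[R]_m -> 'cV[R]_n)
    (K : 'cV[R]_n -> 'cV[R]_l) (gamma : nat -> T -> bool)
    (Mw r eps Delta rho : R) : Prop :=
  forall (x0 : 'cV[R]_n) (w : nat -> T -> 'cV[R]_m),
    `|x0| <= r ->
    (\forall om \ae P, (Linfty_norm (w ^~ om) <= Mw%:E)%E) ->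
    (forall k, measurable_fun setT
       (fun om => `|ncs_state f K (gamma ^~ om) (w ^~ om) x0 k| : R)) ->
    (limn_esup (fun k =>
       P [set om | (eps + Delta
                    <= `|ncs_state f K (gamma ^~ om) (w ^~ om) x0 k|)%R])
     <= rho%:E)%E.

(* Practical safety in probability for the tolerances eps, Delta in D. With
   D always true a level rho < 1 would be required for arbitrarily small
   eps + Delta, which a persistent disturbance rules out in general. *)
Definition practically_safe (R : realType) (d : measure_display)
    (T : measurableType d) (P : probability T R) (n l m : nat)
    (f : 'cV[R]_n -> 'cV[R]_l -> 'cV[R]_m -> 'cV[R]_n)
    (K : 'cV[R]_n -> 'cV[R]_l) (gamma : nat -> T -> bool)
    (D : R -> R -> Prop) (Mw r : R) : Prop :=
  forall eps Delta : R, 0 < eps -> 0 < Delta -> D eps Delta ->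
    exists2 rho : R, 0 < rho < 1 &
      psp_bound P f K gamma Mw r eps Delta rho.

(* Main.v *)
(** Along the closed loop, W_k = V_(gamma_(k-1)) (z_k) satisfies
    W_(k+1) <= varrho lam(gamma_k) W_k + chi(Mw), since changing the Lyapunov
    function costs a factor varrho. The disturbance may depend on the whole
    dropout sequence, so W is first replaced by the solution Y of the
    corresponding affine recursion with equality, which depends on
    gamma_0, ..., gamma_(k-1) only. Given the past up to time k - 1, the policy
    bounds the mean of varrho lam(gamma_k) by eta, whence
    E Y_(k+1) <= eta E Y_k + chi(Mw) for k >= 1 and
    limsup E Y_k <= chi(Mw) / (1 - eta); Markov's inequality concludes.
    As Y_k takes finitely many values, its expectation is a finite sum over
    the possible histories of (s_j, p_j, gamma_j). *)

Require Import Defs.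
From HB Require Import structures.
From mathcomp Require Import all_boot all_order all_algebra finmap.
From mathcomp Require Import all_classical all_reals all_analysis.
From mathcomp Require Import ess_sup_inf.
From mathcomp Require Import ring lra.

Set Implicit Arguments.
Unset Strict Implicit.
Unset Printing Implicit Defensive.

Import Order.TTheory GRing.Theory Num.Theory.
Import numFieldNormedType.Exports.

Local Open Scope classical_set_scope.
Local Open Scope ring_scope.

(** * Finite sums, limits superior, norms and comparison functions *)

Lemma sum_tuple_cons (V : nmodType) (F : finType) (n : nat)
    (G : n.+1.-tuple F -> V) :
  \sum_(t : n.+1.-tuple F) G t
  = \sum_(t : n.-tuple F) \sum_(x : F) G [tuple of x :: t].
Proof.
rewrite pair_bigA /=.
rewrite (reindex (fun p : n.-tuple F * F => [tuple of p.2 :: p.1])) //=.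
exists (fun t : n.+1.-tuple F => ([tuple of behead t], thead t)) => [[t x] _|t _] /=.
  by rewrite theadE; congr pair; exact: val_inj.
by rewrite [RHS]tuple_eta; exact: val_inj.
Qed.

(** The event is a finite disjoint union of fibres of [X], so measurable fibres suffice and [F]
    needs no sigma-algebra. *)
Lemma probability_fin_preimage (R : realType) (d : measure_display)
    (T : measurableType d) (P : probability T R) (F : finType) (X : T -> F)
    (B : pred F) (mX : forall x, measurable [set om | X om = x]) :
  measurable [set om | B (X om)] /\
  P [set om | B (X om)] = (\sum_(x | B x) fine (P [set om | X om = x]))%:E.
Proof.
have -> : [set om | B (X om)]
    = \bigcup_(x in [set x | B x]) [set om | X om = x].
  apply/seteqP; split => om /=; first by move=> h; exists (X om).
  by move=> [x /= Bx ->].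
split; first by apply: fin_bigcup_measurable => // x _; exact: mX.
rewrite measure_fin_bigcup; first last.
- by move=> x _; exact: mX.
- by move=> x y _ _ [om [/= -> ->]].
- exact: finite_finset.
rewrite (_ : [set x | B x] = [set` [seq x <- index_enum F | B x]]); last first.
  by apply/seteqP; split => x /=; rewrite mem_filter mem_index_enum andbT.
rewrite -fsbig_seq ?filter_uniq ?index_enum_uniq // big_filter -sumEFin.
by apply: eq_bigr => x _; rewrite fineK // fin_num_measure.
Qed.

Lemma limn_esup_le_lim (R : realType) (u : nat -> \bar R) (b : nat -> R) (l : R) :
  (forall k, (u k <= (b k)%:E)%E) -> b @ \oo --> l -> (limn_esup u <= l%:E)%E.
Proof.
move=> ub bl.
have cb : (EFin \o b) @ \oo --> l%:E by apply: cvg_EFin => //; exact: nearW.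
have <- : limn_esup (EFin \o b) = l%:E.
  by rewrite is_cvg_limn_esupE ?(cvg_lim _ cb)//; apply/cvg_ex; exists l%:E.
rewrite !limn_esup_lim; apply: lee_lim; [exact: is_cvg_esups..|].
apply: nearW => n; apply: ge_ereal_sup => _ [k /= nk <-].
by apply: le_trans (ub k) _; apply: ereal_sup_ubound; exists k.
Qed.

(** The infinity norm is attained at an entry, whose square is one term of the sum. This links the
    Euclidean bound on the disturbance to the norm inside [chi]. *)
Lemma norm_le_norm2 (R : realType) (m : nat) (v : 'cV[R]_m) : `|v| <= norm2 v.
Proof.
have [->|v0] := eqVneq v 0; first by rewrite normr0 sqrtr_ge0.
have /mx_norm_neq0 [[i j] /= vij] : mx_norm v != 0.
  by apply: contra v0 => /eqP /mx_norm_eq0 ->.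
rewrite [leLHS]vij ord1 -sqrtr_sqr ler_sqrt; last by apply: sumr_ge0 => k _; exact: sqr_ge0.
by rewrite (bigD1 i) //= lerDl; apply: sumr_ge0 => k _; exact: sqr_ge0.
Qed.

Lemma norm_usubmx_le (R : realType) (n m : nat) (z : 'cV[R]_(n + m)) :
  `|usubmx z| <= `|z|.
Proof.
have [->|v0] := eqVneq (usubmx z) 0; first by rewrite normr0.
have /mx_norm_neq0 [[i j] /= vij] : mx_norm (usubmx z) != 0.
  by apply: contra v0 => /eqP /mx_norm_eq0 ->.
rewrite [leLHS]vij mxE.
rewrite /Num.Def.normr /= mx_normE.
exact: (le_bigmax _ (fun i => `|z i.1 i.2|%:nng) (lshift m i, j)).
Qed.

(** Only the empty set is null for the counting measure, so an almost-everywhere bound holds at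
    every time. *)
Lemma Linfty_norm_le (R : realType) (m : nat) (w : nat -> 'cV[R]_m) (b : R) :
  (Linfty_norm w <= b%:E)%E -> forall k, norm2 (w k) <= b.
Proof.
move=> /ess_supP [N [mN]] /=.
have [->|] := pselect (N = set0).
  move=> _ h k; rewrite leNgt; apply/negP => bk.
  by apply: (h k) => /=; rewrite lee_fin leNgt bk.
move=> /eqP/set0P [j Nj]; rewrite /= /counting.
case: asboolP => // fN /eqP.
rewrite eqe pnatr_eq0 cardfs_eq0 => /eqP /(fset_set_set0 fN) N0.
by move: Nj; rewrite N0.
Qed.

Lemma classK_gt0 (R : realType) (alpha : R -> R) (x : R) :
  classK alpha -> 0 < x -> 0 < alpha x.
Proof.
move=> [_ inc a0] x0; rewrite -a0.
by apply: inc => //; rewrite in_itv /= andbT ?lexx ?ltW.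
Qed.

Lemma classK_le (R : realType) (alpha : R -> R) (x y : R) :
  classK alpha -> 0 <= x -> x <= y -> alpha x <= alpha y.
Proof.
move=> [_ inc _] x0; rewrite le_eqVlt => /predU1P [-> //|xy].
by apply/ltW/inc => //; rewrite in_itv /= andbT // (le_trans x0) // ltW.
Qed.

(** * Law of the joint states and dropouts along a path *)

Lemma joint_trans_sum1 (R : realType) (S A : finType) (Omegap : {fset R})
    (M : mdp R S A) (mu : joint_policy Omegap M) (k : nat) (t : S * Omegap) :
  \sum_(t' : S * Omegap) joint_trans mu k t t' = 1.
Proof.
rewrite -(pair_bigA _ (fun s p => joint_trans mu k t (s, p))) /= /joint_trans /=.
under eq_bigr do rewrite -mulr_suml pol_p_sum1 mul1r.
rewrite exchange_big /= -[RHS](pol_m_sum1 mu k t.1); apply: eq_bigr => a aA.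
by rewrite -mulr_suml trans_sum1 // mul1r.
Qed.

Lemma joint_trans_ge0 (R : realType) (S A : finType) (Omegap : {fset R})
    (M : mdp R S A) (mu : joint_policy Omegap M) (k : nat)
    (t t' : S * Omegap) :
  0 <= joint_trans mu k t t'.
Proof.
apply: mulr_ge0; first exact: pol_p_ge0.
by apply: sumr_ge0 => a aA; rewrite mulr_ge0 ?trans_ge0 ?pol_m_ge0.
Qed.

Definition channel_law (R : realType) (S : finType) (Omegap : {fset R})
    (theta : S -> Omegap -> R) (t : S * Omegap) (b : bool) : R :=
  if b then 1 - theta t.1 t.2 else theta t.1 t.2.

Lemma path_eventS (T U : Type) (X : nat -> T -> U) (k : nat) (x : nat -> U) :
  path_event X k.+1 x = [set om | X k.+1 om = x k.+1] `&` path_event X k x.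
Proof.
apply/seteqP; split => om /=.
  by move=> h; split => [|j jk]; apply: h => //; exact: leqW.
by move=> [h1 h2] j; rewrite leq_eqVlt => /predU1P[->|/h2].
Qed.

Lemma measurable_path_event (d : measure_display) (T : measurableType d)
    (U : Type) (X : nat -> T -> U) (k : nat) (x : nat -> U) :
  (forall j u, measurable [set om | X j om = u]) ->
  measurable (path_event X k x).
Proof.
move=> mX; elim: k => [|k IH].
  rewrite (_ : path_event X 0 x = [set om | X 0%N om = x 0%N]) //.
  by apply/seteqP; split => om /= => [h|h j]; [exact: h|rewrite leqn0 => /eqP ->].
by rewrite path_eventS; exact: measurableI.
Qed.

Lemma cprobM (R : realType) (d : measure_display) (T : measurableType d)
    (P : probability T R) (A B : set T) :
  measurable B -> P B != 0%E -> fine (P (A `&` B)) = cprob P A B * fine (P B).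
Proof.
move=> mB PB; rewrite /cprob divfK //.
by rewrite fine_eq0 // fin_num_measure.
Qed.

Lemma measurable_gamma_fiber (R : realType) (d : measure_display)
    (T : measurableType d) (P : probability T R)
    (S : finType) (Omegap : {fset R}) (theta : S -> Omegap -> R)
    (sbar : nat -> T -> S * Omegap) (gamma : nat -> T -> bool) :
  sddc P theta sbar gamma ->
  forall k b, measurable [set om | gamma k om = b].
Proof.
move=> [mg _ _] k b.
rewrite (_ : [set om | _] = gamma k @^-1` [set b]) // -[X in measurable X]setTI.
exact: mg.
Qed.

(** The channel prescribes the case [false]; the case [true] is its complement within the
    conditioning event. *)
Lemma dropout_cprob (R : realType) (d : measure_display)
    (T : measurableType d) (P : probability T R)
    (S : finType) (Omegap : {fset R}) (theta : S -> Omegap -> R)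
    (sbar : nat -> T -> S * Omegap) (gamma : nat -> T -> bool)
    (k : nat) (t : S * Omegap) (b : bool) :
  (forall k t, measurable [set om | sbar k om = t]) ->
  sddc P theta sbar gamma ->
  P [set om | sbar k om = t] != 0%E ->
  cprob P [set om | gamma k om = b] [set om | sbar k om = t]
  = channel_law theta t b.
Proof.
move=> msb hs Pt; have mgb := measurable_gamma_fiber hs.
have [_ hth _] := hs.
have hf : cprob P [set om | gamma k om = false] [set om | sbar k om = t]
    = theta t.1 t.2 by case: t Pt => i p Pt; exact: hth.
case: b => //=; rewrite -hf.
apply: (@mulIf _ (fine (P [set om | sbar k om = t]))).
  by rewrite fine_eq0 // fin_num_measure.
rewrite mulrBl mul1r -!cprobM //.
have fi c : P ([set om | gamma k om = c] `&` [set om | sbar k om = t]) \is a fin_num.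
  by apply: fin_num_measure; exact: measurableI.
apply/eqP; rewrite eq_sym subr_eq -fineD // -measureU //; try exact: measurableI; last first.
  by apply/seteqP; split => om //= [[-> _] []].
rewrite -setIUl (_ : _ `|` _ = setT) ?setTI //.
by apply/seteqP; split => om //= _; case: (gamma k om); [left|right].
Qed.

Lemma path_event_pair (T U W : Type) (X : nat -> T -> U) (Y : nat -> T -> W)
    (k : nat) (u : nat -> U * W) :
  path_event (fun j om => (X j om, Y j om)) k u
  = path_event Y k (snd \o u) `&` path_event X k (fst \o u).
Proof.
apply/seteqP; split => om /=.
  by move=> h; split => j /h /= <-.
by move=> [h1 h2] j jk; rewrite [RHS]surjective_pairing (h1 j) ?(h2 j).
Qed.

(** Conditional independence factorises the dropouts given the joint path. If that path is null,
    both sides vanish. *)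
Lemma path_prob (R : realType) (d : measure_display)
    (T : measurableType d) (P : probability T R)
    (S : finType) (Omegap : {fset R}) (theta : S -> Omegap -> R)
    (sbar : nat -> T -> S * Omegap) (gamma : nat -> T -> bool)
    (k : nat) (u : nat -> S * Omegap * bool) :
  (forall k t, measurable [set om | sbar k om = t]) ->
  sddc P theta sbar gamma ->
  fine (P (path_event (fun j om => (sbar j om, gamma j om)) k u))
  = fine (P (path_event sbar k (fst \o u)))
    * \prod_(j < k.+1) channel_law theta (u j).1 (u j).2.
Proof.
move=> ms hs; have mg := measurable_gamma_fiber hs.
have mps := measurable_path_event k (fst \o u) ms.
have mpg := measurable_path_event k (snd \o u) mg.
rewrite path_event_pair.
have [P0|P0] := eqVneq (P (path_event sbar k (fst \o u))) 0%E.
  rewrite P0 mul0r (subset_measure0 _ _ _ P0) //; first exact: measurableI.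
rewrite cprobM // mulrC; congr (_ * _).
have [_ _ ->] // := hs; apply: eq_bigr => j _.
(* Each single-time event contains the path event, hence also has positive probability. *)
apply: dropout_cprob => //; apply: contra P0 => /eqP P0; apply/eqP.
by apply: (subset_measure0 _ _ _ P0) => // om; apply; rewrite -ltnS.
Qed.

(** The Markov clause conditions on past joint states, not on past dropouts. Applying [path_prob] at
    both times removes the dropouts, so the clause extends to the pair process. *)
Lemma path_prob_step (R : realType) (d : measure_display)
    (T : measurableType d) (P : probability T R)
    (S A : finType) (Omegap : {fset R}) (M : mdp R S A)
    (theta : S -> Omegap -> R) (mu : joint_policy Omegap M)
    (sbar : nat -> T -> S * Omegap) (gamma : nat -> T -> bool)
    (k : nat) (u : nat -> S * Omegap * bool) :
  joint_chain P mu sbar -> sddc P theta sbar gamma ->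
  let Z j om := (sbar j om, gamma j om) in
  fine (P (path_event Z k.+1 u))
  = fine (P (path_event Z k u))
    * (joint_trans mu k (u k).1 (u k.+1).1
       * channel_law theta (u k.+1).1 (u k.+1).2).
Proof.
move=> [ms hJ] hs /=; rewrite !(path_prob _ _ ms hs) big_ord_recr /=.
rewrite [RHS]mulrACA; congr (_ * _).
have mps := measurable_path_event k (fst \o u) ms.
rewrite path_eventS; have [P0|P0] := eqVneq (P (path_event sbar k (fst \o u))) 0%E.
  rewrite P0 mul0r (subset_measure0 _ _ _ P0) //; first exact: measurableI.
by rewrite cprobM // hJ // mulrC.
Qed.

(** * Histories as tuples *)

(* Newest entry first. *)
Fixpoint history (T U : Type) (Z : nat -> T -> U) (k : nat) (om : T) : k.-tuple U :=
  if k is k'.+1 then [tuple of Z k' om :: history Z k' om] else [tuple].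

(** Newest-first storage puts time [j] at index [k - j]. This index is always in range, so the
    default [x0] is never read. *)
Lemma path_event_history (T U : Type) (Z : nat -> T -> U) (x0 : U) (k : nat)
    (s : k.+1.-tuple U) :
  [set om | history Z k.+1 om = s] = path_event Z k (fun j => nth x0 s (k - j)).
Proof.
elim: k s => [|k IH] s.
  apply/seteqP; split => om /=.
    by move=> <- j; rewrite leqn0 => /eqP ->.
  move=> /(_ 0%N (leqnn _)) /= h.
  by apply/val_inj => /=; case/tupleP: s h => y t -> /=; rewrite (tuple0 t).
case/tupleP: s => y t; rewrite path_eventS subnn.
transitivity ([set om | Z k.+1 om = y] `&` [set om | history Z k.+1 om = t]).
  apply/seteqP; split => om /=.
    by move=> /(congr1 val) /= [<- h]; split => //; apply/val_inj.
  by move=> [-> <-]; apply/val_inj.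
congr (_ `&` _); rewrite IH.
by apply/seteqP; split => om h j jk; rewrite h // subSn.
Qed.

Lemma history_prob_step (R : realType) (d : measure_display)
    (T : measurableType d) (P : probability T R)
    (S A : finType) (Omegap : {fset R}) (M : mdp R S A)
    (theta : S -> Omegap -> R) (mu : joint_policy Omegap M)
    (sbar : nat -> T -> S * Omegap) (gamma : nat -> T -> bool)
    (k : nat) (s : k.+1.-tuple (S * Omegap * bool)) (x : S * Omegap * bool) :
  joint_chain P mu sbar -> sddc P theta sbar gamma ->
  let Z j om := (sbar j om, gamma j om) in
  fine (P [set om | history Z k.+2 om = [tuple of x :: s]])
  = fine (P [set om | history Z k.+1 om = s])
    * (joint_trans mu k (thead s).1 x.1 * channel_law theta x.1 x.2).
Proof.
move=> hJ hs Z; rewrite !(path_event_history _ x).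
rewrite (path_prob_step _ _ hJ hs) -/Z subnn subSnn /thead (tnth_nth x) /=.
congr (fine (P _) * _).
(* For [j <= k], index [k.+1 - j] in [x :: s] is index [k - j] in [s]. *)
by apply/seteqP; split => om h j jk; rewrite h // subSn.
Qed.

Lemma measurable_history (d : measure_display) (T : measurableType d)
    (U : Type) (Z : nat -> T -> U) (k : nat) (s : k.-tuple U) :
  (forall j u, measurable [set om | Z j om = u]) ->
  measurable [set om | history Z k om = s].
Proof.
move=> mZ; case: k s => [|k] s; last first.
  by rewrite (path_event_history _ (thead s)); exact: measurable_path_event.
rewrite (_ : [set om | _] = setT) //.
by apply/seteqP; split => om //= _; rewrite [RHS]tuple0.
Qed.

(** * One-step drift and expectation of the affine recursion *)

(** Averaging over the dropout gives [g true + theta * (g false - g true)]. As the transition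
    probabilities sum to 1, the policy condition is exactly a bound on the mean gain. *)
Lemma drift_le (R : realType) (S A : finType) (Omegap : {fset R})
    (M : mdp R S A) (theta : S -> Omegap -> R) (mu : joint_policy Omegap M)
    (k : nat) (t : S * Omegap) (g : bool -> R) (eta : R) :
  g true < g false ->
  \sum_(t' : S * Omegap) theta t'.1 t'.2 * joint_trans mu k t t'
    <= (eta - g true) / (g false - g true) ->
  \sum_(x : S * Omegap * bool)
     joint_trans mu k t x.1 * channel_law theta x.1 x.2 * g x.2 <= eta.
Proof.
rewrite -subr_gt0 => g0; rewrite ler_pdivlMr // => h.
rewrite -(pair_bigA _ (fun t' b => joint_trans mu k t t' * channel_law theta t' b * g b)) /=.
under eq_bigr => t' _.
  rewrite big_bool /= (_ : _ + _ = joint_trans mu k t t' * g true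
    + theta t'.1 t'.2 * joint_trans mu k t t' * (g false - g true)); last by ring.
  over.
by rewrite big_split /= -!mulr_suml joint_trans_sum1 mul1r -lerBrDl.
Qed.

(** On a newest-first history [foldr] applies the oldest step first, which gives the recursion
    Y_(k+1) = g(x_k) Y_k + b with Y_0 = c. *)
Definition affine_gain (R : realType) (U : Type) (g : U -> R) (b c : R)
    (s : seq U) : R :=
  foldr (fun x v => g x * v + b) c s.

Lemma affine_gain_ge0 (R : realType) (U : Type) (g : U -> R) (b c : R)
    (s : seq U) :
  (forall x, 0 <= g x) -> 0 <= b -> 0 <= c -> 0 <= affine_gain g b c s.
Proof.
by move=> g0 b0 c0; elim: s => //= x s IH; rewrite addr_ge0 // mulr_ge0.
Qed.

Section SwitchedExpectation.
Context (R : realType) (d : measure_display) (T : measurableType d)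
  (P : probability T R) (S A : finType) (Omegap : {fset R}) (M : mdp R S A)
  (theta : S -> Omegap -> R) (mu : joint_policy Omegap M)
  (sbar : nat -> T -> S * Omegap) (gamma : nat -> T -> bool)
  (hsbar : joint_chain P mu sbar) (hgamma : sddc P theta sbar gamma).

Let Z (j : nat) (om : T) := (sbar j om, gamma j om).

(** The expectation of [F (history Z k)]. *)
Definition history_expectation (k : nat) (F : k.-tuple (S * Omegap * bool) -> R) : R :=
  \sum_(s : k.-tuple (S * Omegap * bool)) fine (P [set om | history Z k om = s]) * F s.

Let measurable_history_fiber k (s : k.-tuple (S * Omegap * bool)) :
  measurable [set om | history Z k om = s].
Proof.
apply: measurable_history => j [t b].
rewrite (_ : [set om | _] = [set om | sbar j om = t] `&` [set om | gamma j om = b]).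
  by apply: measurableI; [exact: hsbar.1|exact: (measurable_gamma_fiber hgamma)].
by apply/seteqP; split => om; rewrite /Z /= => -[-> ->].
Qed.

Lemma history_expectation_cst k (b : R) :
  history_expectation (fun _ : k.-tuple _ => b) = b.
Proof.
have [_] := probability_fin_preimage P predT (@measurable_history_fiber k).
rewrite (_ : [set om | _] = setT) ?probability_setT; last exact/seteqP.
by move=> [h]; rewrite /history_expectation -mulr_suml -h mul1r.
Qed.

(** Markov's inequality, checked term by term in the finite sum. *)
Lemma history_markov k (F : k.-tuple (S * Omegap * bool) -> R) (c : R) :
  0 < c -> (forall s, 0 <= F s) ->
  measurable [set om | c <= F (history Z k om)] /\
  (P [set om | (c <= F (history Z k om))%R] <= (history_expectation F / c)%:E)%E.
Proof.
move=> c0 F0.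
have [mE ->] := probability_fin_preimage P (fun s => c <= F s)
  (@measurable_history_fiber k).
split => //; rewrite lee_fin ler_pdivlMr // mulr_suml big_mkcond /=.
apply: ler_sum => s _; have P0 := fine_ge0 (measure_ge0 P [set om | history Z k om = s]).
by case: ifP => [cF|_]; [exact: ler_wpM2l|exact: mulr_ge0].
Qed.

(* The first step is excluded: the law of the initial joint state is arbitrary. *)
Lemma affine_gain_expectation_step (g : bool -> R) (b c eta : R) k :
  (forall i, 0 <= g i) -> 0 <= b -> 0 <= c ->
  (forall k t, \sum_(x : S * Omegap * bool)
     joint_trans mu k t x.1 * channel_law theta x.1 x.2 * g x.2 <= eta) ->
  history_expectation
    (fun s : k.+2.-tuple _ => affine_gain (fun x => g x.2) b c s)
  <= eta * history_expectation
       (fun s : k.+1.-tuple _ => affine_gain (fun x => g x.2) b c s) + b.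
Proof.
move=> g0 b0 c0 hdrift; set Y := affine_gain _ b c.
have Y0 s : 0 <= Y s by exact: affine_gain_ge0.
(* Writing [b] as an expectation over the longer histories reduces the claim to an inequality for
   each prefix [s]. *)
rewrite -[X in _ <= _ + X](history_expectation_cst k.+2 b).
rewrite /history_expectation !(@sum_tuple_cons _ _ k.+1) mulr_sumr -big_split /=.
apply: ler_sum => s _.
have -> : \sum_x fine (P [set om | history Z k.+2 om = [tuple of x :: s]])
    * Y [tuple of x :: s]
  = fine (P [set om | history Z k.+1 om = s]) * Y s
    * (\sum_x joint_trans mu k (thead s).1 x.1 * channel_law theta x.1 x.2 * g x.2)
    + \sum_x fine (P [set om | history Z k.+2 om = [tuple of x :: s]]) * b.
  rewrite mulr_sumr -big_split /=; apply: eq_bigr => x _.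
  by rewrite (history_prob_step _ _ hsbar hgamma) -/Z /Y /=; ring.
rewrite lerD2r mulrC; apply: ler_wpM2r => //.
by rewrite mulr_ge0 // fine_ge0.
Qed.

Lemma affine_gain_expectation_le (g : bool -> R) (b c eta : R) :
  (forall i, 0 <= g i) -> 0 <= b -> 0 <= c -> 0 < eta < 1 ->
  (forall k t, \sum_(x : S * Omegap * bool)
     joint_trans mu k t x.1 * channel_law theta x.1 x.2 * g x.2 <= eta) ->
  exists C, forall k,
    history_expectation (fun s : k.-tuple _ => affine_gain (fun x => g x.2) b c s)
    <= b / (1 - eta) + C * eta ^+ k.
Proof.
move=> g0 b0 c0 /andP[eta0 eta1] hdrift.
set E := fun k => history_expectation (fun s : k.-tuple _ => affine_gain (fun x => g x.2) b c s).
have E0 k : 0 <= E k.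
  apply: sumr_ge0 => s _; apply: mulr_ge0; first exact: fine_ge0.
  exact: affine_gain_ge0.
have L0 : 0 <= b / (1 - eta) by rewrite divr_ge0 // subr_ge0 ltW.
(* [E 0] covers [k = 0]. [E 1 / eta] covers [k = 1], where the induction starts because the step
   inequality begins there. *)
exists (E 0%N + E 1%N / eta); case => [|k].
  rewrite expr0 mulr1 -/(E 0%N) addrA addrAC ler_wpDl //.
  by rewrite addr_ge0 // divr_ge0 // ltW.
elim: k => [|k IH].
  rewrite expr1 mulrDl divfK ?gt_eqF // addrA -/(E 1%N) lerDr.
  by rewrite addr_ge0 // mulr_ge0 // ltW.
apply: (le_trans (affine_gain_expectation_step k g0 b0 c0 hdrift)).
(* [b / (1 - eta)] is the fixed point of v -> eta v + b, so the bound reproduces itself with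
   equality. *)
rewrite -lerBrDr; apply: le_trans (ler_wpM2l (ltW eta0) IH) _.
rewrite [in X in _ <= X](exprS _ k.+1) le_eqVlt; apply/orP; left; apply/eqP.
by field; lra.
Qed.

End SwitchedExpectation.

(** * Domination of the Lyapunov functions along the closed loop *)

Section LyapunovDomination.
Context (R : realType) (n l m : nat)
  (f : 'cV[R]_n -> 'cV[R]_l -> 'cV[R]_m -> 'cV[R]_n)
  (K : 'cV[R]_n -> 'cV[R]_l)
  (V : bool -> 'cV[R]_(n + n) -> R) (alpha1 alpha2 chi : R -> R)
  (halpha1 : classK alpha1) (halpha2 : classK alpha2) (hchi : classK chi)
  (varrho : R) (lam : bool -> R) (hvarrho : 0 < varrho)
  (hlam : forall i, 0 < lam i)
  (hV1 : forall i (y : 'cV[R]_(n + n)), alpha1 `|y| <= V i y <= alpha2 `|y|)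
  (hV2 : forall i y (w : 'cV[R]_m),
     V i (closed_loop f K i y w) <= lam i * V i y + chi `|w|)
  (hV3 : forall (i j : bool) (y : 'cV[R]_(n + n)),
     i != j -> V i y <= varrho * V j y).

(* At y <> 0 the two comparisons between V_0 and V_1 force varrho >= 1. *)
Lemma lyapunov_switch_le (i j : bool) (y : 'cV[R]_(n + n)) :
  V i y <= varrho * V j y.
Proof.
have [<-|/hV3 //] := eqVneq i j.
have [y0|y0] := eqVneq y 0.
  have [a10 a20] : alpha1 0 = 0 /\ alpha2 0 = 0.
    by case: halpha1 => _ _ ->; case: halpha2 => _ _ ->.
  have := hV1 i y; rewrite y0 normr0 a10 a20 -eq_le => /eqP <-.
  by rewrite mulr0.
have Vp k : 0 < V k y.
  have /andP[h _] := hV1 k y; apply: lt_le_trans h.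
  by apply: classK_gt0 => //; rewrite normr_gt0.
have ij : i != ~~ i by case: i.
have h1 := hV3 y ij; have h2 : V (~~ i) y <= varrho * V i y by apply: hV3; rewrite eq_sym.
(* Switching to the other function and back costs [varrho ^+ 2], while [V i y] is positive. *)
have : 1 <= varrho ^+ 2.
  rewrite -(ler_pM2r (Vp i)) mul1r expr2 -mulrA; apply: le_trans h1 _.
  by rewrite ler_pM2l.
rewrite -{1}(expr1n _ 2) ler_sqr ?nnegrE ?(ltW hvarrho) // => rho1.
by apply: ler_peMl => //; exact: ltW.
Qed.

(** At each step, passing from the previous index to [gam k om] costs [varrho], and the matching
    mode then gives the factor [lam]. The bound sees [w] only through [Mw]. *)
Lemma ext_state_lyapunov_le (T U : Type) (sb : nat -> T -> U)
    (gam : nat -> T -> bool) (om : T) (w : nat -> 'cV[R]_m) (x0 : 'cV[R]_n)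
    (Mw : R) :
  (forall k, `|w k| <= Mw) ->
  forall k, exists i, V i (ext_state f K (gam ^~ om) w x0 k)
    <= affine_gain (fun x : U * bool => varrho * lam x.2) (chi Mw)
         (alpha2 `|col_mx x0 0 : 'cV[R]_(n + n)|)
         (history (fun j om => (sb j om, gam j om)) k om).
Proof.
move=> wM; elim=> [|k [i IH]].
  (* No mode precedes time 0, so any index serves. *)
  by exists true => /=; have /andP[] := hV1 true (col_mx x0 0).
exists (gam k om) => /=; apply: le_trans (hV2 _ _ _) _.
apply: lerD; last exact: classK_le.
rewrite [varrho * _]mulrC -mulrA ler_pM2l //.
by apply: le_trans (lyapunov_switch_le _ i _) _; rewrite ler_pM2l.
Qed.
End LyapunovDomination.

(** * The limit superior bound and practical safety *)

Theorem theoremV7 (R : realType) (d : measure_display) (T : measurableType d)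
    (P : probability T R)
    (S A : finType) (M : mdp R S A) (Omegap : {fset R})
    (theta : S -> Omegap -> R) (htheta : dropout_prob theta)
    (n l m : nat)
    (f : 'cV[R]_n -> 'cV[R]_l -> 'cV[R]_m -> 'cV[R]_n)
    (K : 'cV[R]_n -> 'cV[R]_l)
    (Mw : R) (hMw : 0 < Mw)
    (V : bool -> 'cV[R]_(n + n) -> R)
    (alpha1 alpha2 chi : R -> R)
    (halpha1 : classKoo alpha1) (halpha2 : classKoo alpha2)
    (hchi : classK chi)
    (varrho : R) (lam : bool -> R)
    (hvarrho : 0 < varrho) (hlam : forall i, 0 < lam i)
    (hV1 : forall i (y : 'cV[R]_(n + n)), alpha1 `|y| <= V i y <= alpha2 `|y|)
    (hV2 : forall i y (w : 'cV[R]_m),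
       V i (closed_loop f K i y w) <= lam i * V i y + chi `|w|)
    (hV3 : forall (i j : bool) (y : 'cV[R]_(n + n)), i != j -> V i y <= varrho * V j y)
    (hV4 : varrho * Num.min (lam false) (lam true) < 1)
    (hlam10 : lam true < lam false)
    (hlam1 : varrho * lam true < 1)
    (eta : R) (heta : lam true * varrho < eta < 1)
    (mu : joint_policy Omegap M)
    (hmu : forall (k : nat) (t : S * Omegap),
       \sum_(t' : S * Omegap) theta t'.1 t'.2 * joint_trans mu k t t'
       <= (eta - lam true * varrho)
          / (varrho * (lam false - lam true)))
    (sbar : nat -> T -> S * Omegap) (hsbar : joint_chain P mu sbar)
    (gamma : nat -> T -> bool) (hgamma : sddc P theta sbar gamma) :
  let rho (eps Delta : R) := chi Mw / ((1 - eta) * alpha1 (Delta + eps)) in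
  forall r : R, 0 <= r ->
    practically_safe P f K gamma (fun eps Delta => rho eps Delta < 1) Mw r /\
    (forall eps Delta : R, 0 < eps -> 0 < Delta ->
       psp_bound P f K gamma Mw r eps Delta (rho eps Delta)).

Proof.
move=> rho r r0.
have /andP[eta0 eta1] := heta.
have [[hK1 _] [hK2 _]] := (halpha1, halpha2).
have eta_gt0 : 0 < eta by apply: lt_trans eta0; exact: mulr_gt0.
have chi0 : 0 < chi Mw by exact: classK_gt0.
have rho0 eps Delta : 0 < eps -> 0 < Delta -> 0 < rho eps Delta.
  move=> e0 D0; rewrite divr_gt0 // mulr_gt0 ?subr_gt0 //.
  by apply: classK_gt0 => //; exact: addr_gt0.
have main eps Delta : 0 < eps -> 0 < Delta ->
    psp_bound P f K gamma Mw r eps Delta (rho eps Delta).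
  move=> e0 D0 x0 w _ [N [mN PN wN]] mx.
  have c_gt0 : 0 < alpha1 (Delta + eps) by apply: classK_gt0 => //; exact: addr_gt0.
  pose c0 := alpha2 `|col_mx x0 0 : 'cV[R]_(n + n)|.
  have c0_ge0 : 0 <= c0.
    have /andP[h1 h2] := hV1 true (col_mx x0 0).
    apply: le_trans (le_trans h1 h2).
    by have [_ _ <-] := hK1; apply: classK_le.
  pose g b := varrho * lam b.
  have g0 b : 0 <= g b by rewrite mulr_ge0 // ltW.
  have hdrift k t : \sum_(x : S * Omegap * bool)
      joint_trans mu k t x.1 * channel_law theta x.1 x.2 * g x.2 <= eta.
    (* With [g b = varrho * lam b], the threshold of [drift_le] becomes the one in [hmu]. *)
    apply: drift_le; first by rewrite /g ltr_pM2l.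
    by rewrite /g -mulrBr [varrho * lam true]mulrC.
  have [|C hC] := affine_gain_expectation_le hsbar hgamma g0 (ltW chi0) c0_ge0 _ hdrift.
    by rewrite eta_gt0.
  apply: (@limn_esup_le_lim _ _
    (fun k => (chi Mw / (1 - eta) + C * eta ^+ k) / alpha1 (Delta + eps))).
    move=> k.
    have [] := history_markov hsbar hgamma (k := k)
      (F := fun s => affine_gain (fun x => g x.2) (chi Mw) c0 s) c_gt0.
      by move=> s; apply: affine_gain_ge0 => //; exact: ltW.
    set E := [set om | _] => mE PE.
    apply: (@le_trans _ _ (P E)); last first.
      by apply: le_trans PE _; rewrite lee_fin ler_pM2r ?invr_gt0 // hC.
    set X := [set om | _].
    have mX : measurable X.
      rewrite (_ : X = (fun om => `|ncs_state f K (gamma ^~ om) (w ^~ om) x0 k| : R)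
        @^-1` `[eps + Delta, +oo[%classic).
        by rewrite -[X in measurable X]setTI; exact: mx.
      by apply/seteqP; split => om; rewrite /X /= in_itv /= andbT.
    (* Off the null set [N] the disturbance bound holds, so exit forces the affine recursion to
       reach [alpha1 (Delta + eps)]: [x_k] is a block of [z_k], and [alpha1] of its norm is at most
       [V i]. *)
    have XEN : X `<=` E `|` N.
      move=> om Xom; have [oN|oN] := pselect (N om); [by right|left].
      have wM j : `|w j om| <= Mw.
        apply: le_trans (norm_le_norm2 _) _.
        apply: (Linfty_norm_le (w := w ^~ om)).
        by apply: contrapT => h; apply: oN; apply: wN.
      have [i Vi] := ext_state_lyapunov_le hK1 hK2 hchi hvarrho hlam hV1 hV2 hV3
        sbar gamma om x0 wM k.
      rewrite /E /=; apply: le_trans Vi.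
      have /andP[+ _] := hV1 i (ext_state f K (gamma ^~ om) (w ^~ om) x0 k).
      apply: le_trans; apply: classK_le => //; first by rewrite addr_ge0 // ltW.
      by rewrite addrC; apply: le_trans Xom _; exact: norm_usubmx_le.
    apply: (@le_trans _ _ (P (E `|` N))).
      by apply: le_measure => //; rewrite inE //; exact: measurableU.
    apply: le_trans (measureU2 _ _ _) _ => //.
    by rewrite [X in (_ + X <= _)%E](_ : _ = 0%E) ?adde0 //; exact: PN.
  (* The geometric term, which carries the initial condition, tends to 0. *)
  rewrite /rho invfM mulrA; apply: cvgMl.
  rewrite -[X in _ --> X]addr0; apply: cvgD; first exact: cvg_cst.
  rewrite -[X in _ --> X](mulr0 C); apply: cvgMr.
  by apply: cvg_expr; rewrite ger0_norm // ltW.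
(* The admissible tolerances are those with [rho eps Delta < 1], so this value serves as the
   level. *)
split => // eps Delta e0 D0 rho1.
by exists (rho eps Delta); [rewrite rho0|exact: main].
Qed.
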